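(* Consider federated learning with low-rank adaptation (LoRA) of rank $r$ in each of the $L$ layers of a model, over a set $\mathcal{S}$ of participating clients indexed $n=1,\dots,|\mathcal{S}|$, with aggregation weights $\alpha_n$, local losses $\mathcal{L}_n$, global loss $\mathcal{L}(x)=\sum_{n\in\mathcal{S}}\alpha_n\mathcal{L}_n(x)$, $\mathcal{L}^*:=\min_x\mathcal{L}(x)$, and learning rate $\eta$. Let layer $l$ have a weight matrix of size $h_l\times w_l$, and put $k_l=\min(h_l,w_l)$ and $K=\sum_{l=1}^{L}k_l$. Let $g_n(w)$ be the stochastic gradient of client $n$ at $w$. Assume: (1) (smoothness) the (non-convex) loss of the clients is $\beta$-smooth, with $\beta$ a constant: $\|\nabla\mathcal{L}(w_1)-\nabla\mathcal{L}(w_2)\|\le\beta\|w_1-w_2\|$ for all $w_1,w_2$; (2) (unbiased gradient) $\mathbb{E}_{\xi|D_n}[g_n(w)]=\nabla\mathcal{L}_n(w)$ for all $n,w$, where $\xi$ is a random batch from the local dataset $D_n$ of client $n$; (3) (bounded variance) $\mathbb{E}\left[\|g_n(w)-\nabla\mathcal{L}_n(w)\|^2\right]\le\sigma^2$ for all $n,w$; (4) (bounded gradient) the singular values of the full-rank gradient matrix of the central model are bounded by $M$: $M\ge\sigma_{l,1}\ge\sigma_{l,2}\ge\dots\ge\sigma_{l,k_l}$ for every layer $l$. The gap $\nabla\mathcal{L}(x(t))-\nabla\mathcal{L}_n(x_n(t))$ between the central and local gradients is represented by the low-rank approximation error of LoRA: in layer $l$ the full gradient is $G_l=\sum_{i=1}^{k_l}\sigma_{l,i}u_{l,i}v_{l,i}^T$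 (singular value decomposition), the LoRA gradient retains its $r$ largest singular values, $G_{l,\mathrm{LoRA}}=\sum_{i=1}^{r}\sigma_{l,i}u_{l,i}v_{l,i}^T$, and the gap is $\Delta G_l=G_l-G_{l,\mathrm{LoRA}}$, with total size $\|\Delta G_{total}\|_F=\left(\sum_{l=1}^{L}\|\Delta G_l\|_F^2\right)^{1/2}\le M\sqrt{K-Lr}$. Let the central model be updated by $x(t+1)=x(t)-\eta\sum_{n=1}^{|\mathcal{S}|}\alpha_n g_n(x_n(t))$, where $x(t)$ is the central model and $x_n(t)$ the local model of client $n$ at time $t$, and let the local sub-datasets of all clients have the same size (so that the weights are $\alpha_n=1/|\mathcal{S}|$). Then over $T$ rounds $$\frac1T\sum_{t=1}^{T}\mathbb{E}\left[\|\nabla\mathcal{L}(x(t))\|^2\right]\le\frac{2}{\eta T}\left(\mathbb{E}\left[\mathcal{L}(x(1))-\mathcal{L}^*\right]\right)+\frac{\eta\beta\sigma^2}{|\mathcal{S}|}+M^2(K-Lr).$$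
   Context: Setting: in each communication round a server sends its central model $x(t)$ to the selected clients (vehicles) $\mathcal{S}$; client $n$, with local dataset $D_n$, freezes the received weights and trains only a low-rank product $B_nA_n$ of rank $r$ added to each layer's weights; the server aggregates the local updates with weights $\alpha_n$. $\sigma_{l,i}$ is the $i$-th singular value of the full-rank gradient of layer $l$, with left and right singular vectors $u_{l,i}$ and $v_{l,i}$; $\|\cdot\|_F$ is the Frobenius norm. $K$ is the total number of singular values of all weight matrices of the model, and $Lr$ is the sum of the LoRA ranks of all layers. $\mathcal{L}^*$ is the value to which the central model is wanted to converge at time $T+1$. The number of layers $L$ is distinct from the loss $\mathcal{L}$, and the variance constant $\sigma$ from the singular values $\sigma_{l,i}$.
   Formalization: The learning rate is assumed to satisfy ηβ ≤ 1, and the random batches of each round are assumed independent across clients and independent of the current central and local models; the bound is false without these conditions. *)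

(* Defs.v *)
From HB Require Import structures.
From mathcomp Require Import all_boot all_order all_algebra.
From mathcomp Require Import all_classical all_reals all_analysis.

Set Implicit Arguments.
Unset Strict Implicit.
Unset Printing Implicit Defensive.

Import Order.TTheory GRing.Theory Num.Theory.
Import numFieldNormedType.Exports.

Local Open Scope classical_set_scope.
Local Open Scope ring_scope.

(* The weights of a model with layers of sizes h l x w l, flattened into one
   row vector whose blocks are the layers. *)
Notation weights R h w := 'rV[R]_(\sum_l (h l * w l)%N).

Definition layer (R : realType) (L : nat) (h w : 'I_L -> nat)
    (x : weights R h w) (l : 'I_L) : 'M[R]_(h l, w l) :=
  vec_mx (submxrow x l).

(* The library's norm on matrices is the sup norm; this is the Frobenius norm,
   i.e. the Euclidean norm on row vectors. *)
Definition frobenius_norm (R : realType) (m n : nat) (A : 'M[R]_(m, n)) : R :=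
  Num.sqrt (\sum_i \sum_j A i j ^+ 2).

Definition gradient (R : realType) (d : nat) (f : 'rV[R]_d -> R)
    (x : 'rV[R]_d) : 'rV[R]_d :=
  \row_i 'D_(delta_mx 0 i) f x.

Definition global_loss (R : realType) (N d : nat) (alpha : 'I_N -> R)
    (loss : 'I_N -> 'rV[R]_d -> R) (x : 'rV[R]_d) : R :=
  \sum_n alpha n * loss n x.

Definition is_min_value (T : Type) (R : realType) (f : T -> R) (m : R) : Prop :=
  (exists x, f x = m) /\ (forall x, m <= f x).

(* Row vectors with their Borel sigma-algebra. *)
Definition borel_rV (R : realType) (d : nat) :=
  g_sigma_algebraType (@open 'rV[R]_d).

(* The variables xi i are mutually independent, and jointly independent of the
   family Y (taking A j or C i to be the whole space gives the product rule
   for subfamilies). *)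
Definition fresh_given (d dE dX : measure_display) (Omega : measurableType d)
    (R : realType) (P : probability Omega R) (E : measurableType dE)
    (X : measurableType dX) (I J : finType)
    (Y : J -> Omega -> E) (xi : I -> Omega -> X) : Prop :=
  forall (A : J -> set E) (C : I -> set X),
    (forall j, measurable (A j)) -> (forall i, measurable (C i)) ->
    P ((\bigcap_(j in [set: J]) Y j @^-1` A j) `&`
       (\bigcap_(i in [set: I]) xi i @^-1` C i)) =
    (P (\bigcap_(j in [set: J]) Y j @^-1` A j) *
     \prod_(i : I) P (xi i @^-1` C i))%E.

(* The central model (index None) together with the local models. *)
Definition models (N : nat) (Omega W : Type) (x : Omega -> W)
    (xloc : 'I_N -> Omega -> W) (o : option 'I_N) : Omega -> W :=
  if o is Some n then xloc n else x.

Definition svd_sum (R : realType) (m n : nat) (s : 'I_(minn m n) -> R)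
    (u : 'I_(minn m n) -> 'cV[R]_m) (v : 'I_(minn m n) -> 'cV[R]_n)
    : 'M[R]_(m, n) :=
  \sum_i s i *: (u i *m (v i)^T).

Definition is_svd (R : realType) (m n : nat) (G : 'M[R]_(m, n))
    (s : 'I_(minn m n) -> R)
    (u : 'I_(minn m n) -> 'cV[R]_m) (v : 'I_(minn m n) -> 'cV[R]_n) : Prop :=
  [/\ forall i j, (u i)^T *m u j = (i == j)%:R%:M,
      forall i j, (v i)^T *m v j = (i == j)%:R%:M,
      forall i, 0 <= s i,
      forall i j : 'I_(minn m n), (i <= j)%N -> s j <= s i
    & G = svd_sum s u v].

(* The LoRA gradient: only the r largest singular values are retained. *)
Definition svd_trunc (R : realType) (m n r : nat) (s : 'I_(minn m n) -> R)
    (u : 'I_(minn m n) -> 'cV[R]_m) (v : 'I_(minn m n) -> 'cV[R]_n)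
    : 'M[R]_(m, n) :=
  \sum_(i < minn m n | (i < r)%N) s i *: (u i *m (v i)^T).

(* y is obtained from the frozen weights x by adding a rank-r product B A to
   each layer. *)
Definition lora_model (R : realType) (L r : nat) (h w : 'I_L -> nat)
    (x y : weights R h w) : Prop :=
  forall l, exists (B : 'M[R]_(h l, r)) (A : 'M[R]_(r, w l)),
    layer y l = layer x l + B *m A.

(* Main.v *)
Require Import Defs.
From HB Require Import structures.
From mathcomp Require Import all_boot all_order all_algebra.
From mathcomp Require Import all_classical all_reals all_analysis.
From mathcomp Require Import measurable_realfun ring lra.

Set Implicit Arguments.
Unset Strict Implicit.
Unset Printing Implicit Defensive.

Import Order.TTheory GRing.Theory Num.Theory.
Import numFieldNormedType.Exports.

Local Open Scope classical_set_scope.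
Local Open Scope ring_scope.

(* Write D for the global gradient at x(t), m for the average of the local
   gradients and E for the average of the centred stochastic gradients, so that
   x(t+1) = x(t) - eta (m + E).  The descent lemma for the beta-smooth loss and
   eta beta <= 1 give
     L(x(t+1)) + eta/2 |D|^2 <= L(x(t)) + eta/2 |D - m|^2
        + <E, eta^2 beta m - eta D> + eta^2 beta/2 |E|^2.
   Here |D - m|^2 is at most the sum of the squares of the discarded singular
   values.  The noises of different clients are orthogonal to each other and to
   every square-integrable variable that does not involve the current batch, so
   the last two terms have expectation at most eta^2 beta sigma^2 / (2 N).
   Square-integrability of D comes for free: one gradient step of length eta
   yields eta/2 |D|^2 <= L - L*, hence integrability propagates from round to
   round, and if E[L(x(1)) - L*] is infinite there is nothing to prove.
   Summing over t telescopes. *)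

(** * The Frobenius norm of the low-rank approximation error *)

Lemma sqr_frobenius_norm (R : realType) (m n : nat) (A : 'M[R]_(m, n)) :
  frobenius_norm A ^+ 2 = \sum_i \sum_j A i j ^+ 2.
Proof.
by rewrite sqr_sqrtr//; do 2![apply: sumr_ge0 => ? _]; exact: sqr_ge0.
Qed.

Lemma sqr_frobenius_norm_tr (R : realType) (m n : nat) (A : 'M[R]_(m, n)) :
  frobenius_norm A ^+ 2 = \tr (A *m A^T).
Proof.
rewrite sqr_frobenius_norm; apply: eq_bigr => i _.
by rewrite mxE; apply: eq_bigr => j _; rewrite mxE expr2.
Qed.

Lemma frobenius_norm_ge0 (R : realType) (m n : nat) (A : 'M[R]_(m, n)) :
  0 <= frobenius_norm A.
Proof. exact: sqrtr_ge0. Qed.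

Lemma frobenius_normZ (R : realType) (m n : nat) (a : R) (A : 'M[R]_(m, n)) :
  frobenius_norm (a *: A) = `|a| * frobenius_norm A.
Proof.
apply/eqP; rewrite -(@eqrXn2 _ 2) ?mulr_ge0 ?frobenius_norm_ge0//.
rewrite exprMn real_normK ?num_real// !sqr_frobenius_norm mulr_sumr.
apply/eqP/eq_bigr => i _; rewrite mulr_sumr.
by apply: eq_bigr => j _; rewrite mxE exprMn.
Qed.

(** The blocks partition the coordinates, so [x *m x^T] is the sum of the block products;
    [curry_mxvec_bij] then matches the coordinates of a block with the entries of its matrix. *)
Lemma sqr_frobenius_norm_layer (R : realType) (L : nat) (h w : 'I_L -> nat)
    (x : weights R h w) :
  frobenius_norm x ^+ 2 = \sum_l frobenius_norm (layer x l) ^+ 2.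
Proof.
rewrite sqr_frobenius_norm_tr -[x in LHS]submxrowK tr_mxrow mul_mxrow_mxcol.
rewrite raddf_sum /=; apply: eq_bigr => l _.
rewrite -sqr_frobenius_norm_tr !sqr_frobenius_norm big_ord1 /layer.
rewrite (reindex _ (curry_mxvec_bij _ _)) /=.
rewrite pair_big; apply: eq_bigr => -[i j] _ /=.
by rewrite -[submxrow x l]vec_mxK mxvecE vec_mxK.
Qed.

(** In the trace of the tail times its transpose, orthonormality of the [v i] kills the cross terms,
    and each diagonal term has trace [s i ^+ 2] because [u i] is a unit vector. *)
Lemma sqr_frobenius_norm_svd_tail (R : realType) (m n r : nat)
    (G : 'M[R]_(m, n)) (s : 'I_(minn m n) -> R)
    (u : 'I_(minn m n) -> 'cV[R]_m) (v : 'I_(minn m n) -> 'cV[R]_n) :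
  is_svd G s u v ->
  frobenius_norm (svd_sum s u v - svd_trunc r s u v) ^+ 2 =
    \sum_(i < minn m n | (r <= i)%N) s i ^+ 2.
Proof.
move=> [hu hv _ _ _].
have -> : svd_sum s u v - svd_trunc r s u v =
    \sum_(i < minn m n | (r <= i)%N) s i *: (u i *m (v i)^T).
  rewrite /svd_sum /svd_trunc (bigID (fun i : 'I_ _ => (i < r)%N)) /=.
  by rewrite addrAC subrr add0r; apply: eq_bigl => i; rewrite -leqNgt.
rewrite sqr_frobenius_norm_tr raddf_sum /= mulmx_suml raddf_sum /=.
apply: eq_bigr => i ri; rewrite mulmx_sumr raddf_sum /=.
rewrite (bigD1 i)//= big1 ?addr0 => [|j /andP[_ ji]].
  rewrite linearZ /= -scalemxAl -scalemxAr !linearZ /= trmx_mul trmxK.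
  rewrite mulmxA -(mulmxA (u i)) hv eqxx mulmx1 mxtrace_mulC hu eqxx mxtrace1.
  by rewrite mulr1 expr2.
rewrite linearZ /= -scalemxAl -scalemxAr !linearZ /= trmx_mul trmxK.
rewrite mulmxA -(mulmxA (u i)) hv eq_sym (negPf ji).
by rewrite raddf0 mulmx0 mul0mx mxtrace0 !mulr0.
Qed.

(** Layer [l] discards exactly [minn (h l) (w l) - r] singular values, a true difference by the
    bound on [r]. Being nonnegative and at most [M], each contributes at most [M ^+ 2]. *)
Lemma sqr_frobenius_norm_lora_gap (R : realType) (L r : nat)
    (h w : 'I_L -> nat) (M : R) (x : weights R h w)
    (G : forall l, 'M[R]_(h l, w l))
    (s : forall l, 'I_(minn (h l) (w l)) -> R)
    (u : forall l, 'I_(minn (h l) (w l)) -> 'cV[R]_(h l))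
    (v : forall l, 'I_(minn (h l) (w l)) -> 'cV[R]_(w l)) :
  (forall l, (r <= minn (h l) (w l))%N) ->
  (forall l, is_svd (G l) (s l) (u l) (v l)) ->
  (forall l i, s l i <= M) ->
  (forall l, layer x l =
     svd_sum (s l) (u l) (v l) - svd_trunc r (s l) (u l) (v l)) ->
  frobenius_norm x ^+ 2 <=
    M ^+ 2 * ((\sum_l minn (h l) (w l))%:R - (L * r)%:R).
Proof.
move=> hr hsvd hM hx.
have -> : (L * r)%N = (\sum_(l < L) r)%N by rewrite sum_nat_const card_ord.
rewrite sqr_frobenius_norm_layer !natr_sum -sumrB mulr_sumr.
apply: ler_sum => l _; rewrite hx (sqr_frobenius_norm_svd_tail _ (hsvd l)).
have [_ _ s0 _ _] := hsvd l.
apply: (@le_trans _ _ (\sum_(i < minn (h l) (w l) | (r <= i)%N) M ^+ 2)).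
  by apply: ler_sum => i _; rewrite lerXn2r ?nnegrE ?(le_trans (s0 i)).
rewrite -natrB// sumr_const mulr_natr.
suff -> : #|(fun i : 'I_(minn (h l) (w l)) => (r <= i)%N)| =
  (minn (h l) (w l) - r)%N by [].
by rewrite -sum1_card -(big_geq_mkord _ _ xpredT (fun=> 1%N)) sum_nat_const_nat muln1.
Qed.

(** * The descent lemma *)

Definition dotr (R : realType) (d : nat) (a b : 'rV[R]_d) : R :=
  \sum_i a 0 i * b 0 i.

Section dotr.
Variables (R : realType) (d : nat).
Implicit Types (a b c : 'rV[R]_d) (k : R).

Lemma dotrC a b : dotr a b = dotr b a.
Proof. by apply: eq_bigr => i _; rewrite mulrC. Qed.

Lemma dotrDl a b c : dotr (a + b) c = dotr a c + dotr b c.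
Proof. by rewrite -big_split; apply: eq_bigr => i _; rewrite mxE mulrDl. Qed.

Lemma dotrDr a b c : dotr c (a + b) = dotr c a + dotr c b.
Proof. by rewrite dotrC dotrDl !(dotrC c). Qed.

Lemma dotrZl k a b : dotr (k *: a) b = k * dotr a b.
Proof. by rewrite mulr_sumr; apply: eq_bigr => i _; rewrite mxE mulrA. Qed.

Lemma dotrZr k a b : dotr a (k *: b) = k * dotr a b.
Proof. by rewrite dotrC dotrZl dotrC. Qed.

Lemma dotrNl a b : dotr (- a) b = - dotr a b.
Proof. by rewrite -scaleN1r dotrZl mulN1r. Qed.

Lemma dotrNr a b : dotr a (- b) = - dotr a b.
Proof. by rewrite dotrC dotrNl dotrC. Qed.

Lemma dotr_suml (I : Type) (r : seq I) (A : I -> 'rV[R]_d) b :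
  dotr (\sum_(i <- r) A i) b = \sum_(i <- r) dotr (A i) b.
Proof.
apply: (big_morph (fun a => dotr a b)); first by move=> x y; exact: dotrDl.
by rewrite /dotr big1// => i _; rewrite mxE mul0r.
Qed.

Lemma dotr_sumr (I : Type) (r : seq I) (A : I -> 'rV[R]_d) b :
  dotr b (\sum_(i <- r) A i) = \sum_(i <- r) dotr b (A i).
Proof. by rewrite dotrC dotr_suml; apply: eq_bigr => i _; exact: dotrC. Qed.

Lemma dotr_ge0 a : 0 <= dotr a a.
Proof. by apply: sumr_ge0 => i _; rewrite -expr2 sqr_ge0. Qed.

Lemma sqr_le_dotr a i : a 0 i ^+ 2 <= dotr a a.
Proof.
rewrite /dotr (bigD1 i)//= -expr2 lerDl.
by apply: sumr_ge0 => j _; rewrite -expr2 sqr_ge0.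
Qed.

Lemma sqr_frobenius_norm_dotr a : frobenius_norm a ^+ 2 = dotr a a.
Proof.
by rewrite sqr_frobenius_norm big_ord1; apply: eq_bigr => i _; rewrite expr2.
Qed.

(** This will make the local gradients square-integrable, as they stay within a bounded distance of
    the global one. *)
Lemma sqr_coord_le a b i k : dotr (a - b) (a - b) <= k ->
  b 0 i ^+ 2 <= 2 * dotr a a + 2 * k.
Proof.
move=> abk; have := sqr_le_dotr (a - b) i; have := sqr_le_dotr a i.
by rewrite !mxE => *; have := sqr_ge0 (2 * a 0 i - b 0 i); nra.
Qed.

(** A form of Cauchy-Schwarz: expanding [|a - k b|^2 >= 0] gives [2 k <a, b> <= |a|^2 + k^2 |b|^2 <=
    2 k^2 |b|^2], to be divided by [2 k]. *)
Lemma dotr_le_norm k a b : 0 <= k ->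
  frobenius_norm a <= k * frobenius_norm b -> dotr a b <= k * dotr b b.
Proof.
move=> k0 ab.
have {}ab : dotr a a <= k ^+ 2 * dotr b b.
  rewrite -!sqr_frobenius_norm_dotr -exprMn lerXn2r// nnegrE ?mulr_ge0//;
    exact: frobenius_norm_ge0.
have := dotr_ge0 (a - k *: b).
rewrite dotrDl !dotrDr !dotrNl !dotrNr !dotrZl !dotrZr (dotrC b a).
(* Division is impossible for [k = 0], but then [|a|^2 <= 0] and all coordinates of [a] vanish. *)
move: k0; rewrite le_eqVlt => /predU1P[k0|k0 H].
  move=> _; move: ab; rewrite -k0 expr0n !mul0r => a0.
  rewrite [dotr a b]big1// => i _.
  have := le_trans (sqr_le_dotr a i) a0.
  by rewrite le_eqVlt ltNge sqr_ge0 orbF sqrf_eq0 => /eqP ->; rewrite mul0r.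
rewrite -(ler_pM2l k0); nra.
Qed.

End dotr.

Section descent.
Variables (R : realType) (d : nat) (f : 'rV[R]_d -> R) (beta : R).
Hypothesis df : forall x, differentiable f x.

Lemma derive_gradient (x v : 'rV[R]_d) : 'D_v f x = dotr v (gradient f x).
Proof.
rewrite deriveE// {1}(row_sum_delta v) linear_sum; apply: eq_bigr => i _.
by rewrite linearZ /= mxE deriveE.
Qed.

Lemma is_derive_line (x v : 'rV[R]_d) (s : R) :
  is_derive s 1 (fun s => f (x + s *: v)) (dotr v (gradient f (x + s *: v))).
Proof.
have /derivableP := @diff_derivable _ _ _ f _ v (df (x + s *: v)).
rewrite -derive_gradient.
have E : (fun h : R => h^-1 *: (((fun s => f (x + s *: v)) \o shift s) h%:A -
      f (x + s *: v))) =
    (fun h : R => h^-1 *: ((f \o shift (x + s *: v)) (h *: v) -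
      f (x + s *: v))).
  apply/funext => h /=; congr (_ *: (f _ - _)).
  by rewrite /= [h%:A]mulr1 scalerDl addrCA.
by move=> [D _]; split; rewrite /derivable /derive /= E.
Qed.

Hypothesis beta0 : 0 <= beta.
Hypothesis smooth : forall x y,
  frobenius_norm (gradient f x - gradient f y) <= beta * frobenius_norm (x - y).

Lemma descent (x v : 'rV[R]_d) :
  f (x + v) <= f x + dotr v (gradient f x) + beta / 2 * dotr v v.
Proof.
set c := dotr v (gradient f x); set q := beta / 2 * dotr v v.
(* The claim is [p 1 <= p 0]. The quadratic is chosen so that [p' <= 0] on the segment: the gradient
   moves by at most [beta s |v|], whence its product with [v] grows by at most [2 q s]. *)
pose p (s : R) := f (x + s *: v) - (c * s + q * s ^+ 2).
pose dp (s : R) := dotr v (gradient f (x + s *: v)) - (c + q * (2 * s)).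
have Dp (s : R) : is_derive s 1 p (dp s).
  apply: is_deriveB; first exact: is_derive_line.
  apply: is_deriveD; apply: is_derive_eq; rewrite ?[_ *: _]mulr1//.
  by rewrite [s%:A]mulr1 -mulr2n mulr_natl.
have [s s01] := @MVT_segment R p dp 0 1 ler01 (fun s _ => Dp s)
  (derivable_within_continuous (fun s _ => @ex_derive _ _ _ _ _ _ _ (Dp s))).
rewrite subr0 mulr1 /p scale0r scale1r !addr0 expr1n expr0n/= !mulr0 !mulr1.
suff : dp s <= 0 by rewrite addr0 subr0; lra.
have s0 : 0 <= s by move: s01; rewrite in_itv/= => /andP[].
have := @dotr_le_norm R d (beta * s) (gradient f (x + s *: v) - gradient f x) v.
rewrite mulr_ge0// => /(_ isT).
have := smooth (x + s *: v) x; rewrite addrAC subrr add0r.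
rewrite frobenius_normZ ger0_norm// mulrA.
move=> /[swap] /[apply]; rewrite dotrDl dotrNl dotrC (dotrC _ v) -/c /dp /q.
by lra.
Qed.

(** A gradient step of length [eta] lowers [f] by at least [eta/2] times the squared gradient, and
    cannot take it below [m]. *)
Lemma sqr_gradient_le (m eta : R) x : 0 < eta -> eta * beta <= 1 ->
  (forall y, m <= f y) ->
  eta / 2 * dotr (gradient f x) (gradient f x) <= f x - m.
Proof.
move=> eta0 etab fm; have := descent x (- eta *: gradient f x).
rewrite !dotrZl !dotrZr; set q := dotr _ _.
have := fm (x + - eta *: gradient f x); set y := f (_ + _).
have : eta * (eta * beta * q) <= eta * q.
  by rewrite ler_pM2l// ler_piMl// dotr_ge0.
by move=> *; nra.
Qed.

End descent.

(** * Integrating out an independent variable *)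

Section independent_integral.
Local Open Scope ereal_scope.
Context (d dX : measure_display) (Omega : measurableType d)
  (Xi : measurableType dX) (R : realType).
Variables (P : probability Omega R) (nu : probability Xi R).
Variables (xi : Omega -> Xi) (G : set (set Omega)).
Hypothesis mxi : measurable_fun [set: Omega] xi.
Hypothesis mG : G `<=` measurable.
Hypothesis GI : setI_closed G.
Hypothesis GT : G setT.
Hypothesis indep : forall A C, G A -> measurable C ->
  P (A `&` xi @^-1` C) = P A * nu C.

(* Omega with the sigma-algebra generated by G: taking the first factor of the
   product to be Omega itself avoids naming the variables generating G. *)
Local Notation Past := (g_sigma_algebraType G).

Let mPast (A : set Omega) : <<s G >> A -> measurable A.
Proof. by apply: smallest_sub => //; exact: sigma_algebra_measurable. Qed.

Let mpre C : measurable C -> measurable (xi @^-1` C).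
Proof. by move=> mC; rewrite -[X in measurable X]setTI; exact: mxi. Qed.

(** Dynkin's pi-lambda argument: for fixed [C], the events obeying the product rule form a
    lambda-system containing the pi-system [G]. *)
Lemma indep_sigma_algebra A C : <<s G >> A -> measurable C ->
  P (A `&` xi @^-1` C) = P A * nu C.
Proof.
move=> + mC; move: A.
pose H := [set A | measurable A /\ P (A `&` xi @^-1` C) = P A * nu C].
suff : <<s G >> `<=` H by move=> sub A /sub[].
apply: lambda_system_subset => //; last first.
  by move=> A GA; split; [exact: mG|exact: indep].
split => //.
- by split; [exact: measurableT|exact: indep].
- move=> A B BA [mA HA] [mB HB]; split; first exact: measurableD.
  have PC : P B \is a fin_num by rewrite fin_num_measure.
  rewrite setIDAC setIDA !measureD//; last 3 first.
  - by rewrite ltey_eq fin_num_measure.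
  - exact: measurableI (mpre mC).
  - by rewrite ltey_eq fin_num_measure//; exact: measurableI (mpre mC).
  rewrite setIAC (setIidr BA).
  rewrite [LHS](_ : _ = P (A `&` xi @^-1` C) - P (B `&` xi @^-1` C))//.
  rewrite HA HB -muleBl ?fin_num_measure//.
  by rewrite fin_num_adde_defl// fin_numN.
- move=> F ndF HF; have mF i : measurable (F i) by have [] := HF i.
  split; first exact: bigcup_measurable.
  (* Continuity from below applies to both sides of the product rule, and limits are unique. *)
  have c1 : P (F n) * nu C @[n --> \oo] --> P (\bigcup_n F n) * nu C.
    apply: cvgeZr; first by rewrite fin_num_measure.
    exact: nondecreasing_cvg_mu (bigcup_measurable _) _.
  have c2 : P (F n `&` xi @^-1` C) @[n --> \oo] -->
      P (\bigcup_n (F n `&` xi @^-1` C)).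
    apply: nondecreasing_cvg_mu => [i||m n mn].
    - exact: measurableI (mpre mC).
    - by apply: bigcup_measurable => i _; exact: measurableI (mpre mC).
    - by apply/subsetPset; apply: setSI; exact/subsetPset/ndF.
  rewrite setI_bigcupl; apply: cvg_unique c2 _ => //.
  by apply: cvg_trans c1; apply: near_eq_cvg; apply: nearW => n; exact/esym/(HF n).2.
Qed.

Let phi (omega : Omega) : Past * Xi := (omega, xi omega).

Let mid : measurable_fun [set: Omega] (idfun : Omega -> Past).
Proof. by move=> _ A mA; rewrite setTI; exact: mPast. Qed.

Let mphi : measurable_fun [set: Omega] phi.
Proof. exact: measurable_fun_pair. Qed.

Let idRV : {mfun Omega >-> Past} := mfun_Sub (mem_set mid).
Let phiRV : {mfun Omega >-> (Past * Xi)%type} := mfun_Sub (mem_set mphi).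

(** Independence on rectangles determines the joint law of the past and the batch as a product
    measure, which opens the way to Tonelli and Fubini. *)
Let lawE : forall X : set (Past * Xi), measurable X ->
  (distribution P idRV \x nu) X = distribution P phiRV X.
Proof.
by apply: product_measure_unique => A C mA mC; exact: indep_sigma_algebra.
Qed.

Lemma ge0_integral_indep (Phi : Past * Xi -> \bar R) :
  measurable_fun [set: Past * Xi] Phi -> (forall z, 0 <= Phi z) ->
  \int[P]_omega Phi (omega, xi omega) =
  \int[P]_omega \int[nu]_b Phi (omega, b).
Proof.
move=> mPhi Phi0.
rewrite -(@ge0_integral_distribution _ _ _ _ _ P phiRV Phi)//.
rewrite -(eq_measure_integral _ (fun A mA _ => lawE mA)) fubini_tonelli1//.
rewrite (@ge0_integral_distribution _ _ _ _ _ P idRV)//.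
- exact: measurable_fun_fubini_tonelli_F.
- by move=> y; exact: integral_ge0.
Qed.

Lemma integral_indep_eq0 (Phi : Past * Xi -> \bar R) :
  measurable_fun [set: Past * Xi] Phi ->
  P.-integrable setT (fun omega => Phi (omega, xi omega)) ->
  (forall omega, \int[nu]_b Phi (omega, b) = 0) ->
  \int[P]_omega Phi (omega, xi omega) = 0.
Proof.
move=> mPhi iPhi Phi0.
rewrite -(@integral_distribution _ _ _ _ _ P phiRV Phi)//.
rewrite -(eq_measure_integral _ (fun A mA _ => lawE mA)).
rewrite -integral12_prod_meas1/=.
  by apply: integral0_eq => omega _; exact: Phi0.
(* Fubini needs integrability for the product measure; it is transported from [P] through the
   equality of laws. *)
apply/integrableP; split => //.
rewrite (eq_measure_integral _ (fun A mA _ => lawE mA)).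
rewrite (@ge0_integral_distribution _ _ _ _ _ P phiRV)//.
  by have /integrableP[] := iPhi.
exact: measurableT_comp.
Qed.

End independent_integral.

(** * Integrable and square-integrable variables *)

Section square_integrable.
Context (d : measure_display) (Omega : measurableType d) (R : realType).
Variable P : probability Omega R.
Implicit Types X Y : Omega -> R.

Definition L1 X := P.-integrable [set: Omega] (EFin \o X).
(** Measurability is asked of [X] itself, since that of its square does not imply it. *)
Definition L2 X :=
  measurable_fun [set: Omega] X /\ L1 (fun omega => X omega ^+ 2).

Lemma L1_le X Y : measurable_fun [set: Omega] X ->
  (forall omega, `|X omega| <= Y omega) -> L1 Y -> L1 X.
Proof.
move=> mX XY; apply: le_integrable => //; first exact/measurable_EFinP.
by move=> omega _; rewrite /= lee_fin (le_trans (XY omega))// ler_norm.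
Qed.

Lemma L1_bounded X (c : R) : measurable_fun [set: Omega] X ->
  (forall omega, 0 <= X omega) ->
  (\int[P]_omega (X omega)%:E <= c%:E)%E -> L1 X.
Proof.
move=> mX X0 Xc; apply/integrableP; split; first exact/measurable_EFinP.
apply: le_lt_trans (ltry c); apply: le_trans Xc.
by under eq_integral do rewrite gee0_abs ?lee_fin//.
Qed.

Lemma L1_cst (c : R) : L1 (fun=> c).
Proof. exact: finite_measure_integrable_cst. Qed.

Lemma L1_add X Y : L1 X -> L1 Y -> L1 (fun omega => X omega + Y omega).
Proof. by move=> iX iY; have := integrableD measurableT iX iY. Qed.

Lemma L1_scale (c : R) X : L1 X -> L1 (fun omega => c * X omega).
Proof. by move=> iX; have := integrableZl measurableT c iX. Qed.

Lemma L1_sum (I : Type) (r : seq I) (X : I -> Omega -> R) :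
  (forall i, L1 (X i)) -> L1 (fun omega => \sum_(i <- r) X i omega).
Proof.
move=> iX; have := integrable_sum measurableT r (fun i (_ : true) => iX i).
by apply: eq_integrable => // omega _; rewrite /= sumEFin.
Qed.

Lemma Rintegral_sum (I : Type) (r : seq I) (X : I -> Omega -> R) :
  (forall i, L1 (X i)) ->
  \int[P]_omega (\sum_(i <- r) X i omega) = \sum_(i <- r) \int[P]_omega X i omega.
Proof.
move=> iX; elim: r => [|i r ih].
  rewrite big_nil; under eq_Rintegral do rewrite big_nil.
  by rewrite Rintegral_cst// mul0r.
rewrite big_cons -ih; under eq_Rintegral do rewrite big_cons.
by rewrite RintegralD//; [exact: iX|exact: (L1_sum r iX)].
Qed.

Lemma L2_le X Y : measurable_fun [set: Omega] X ->
  (forall omega, X omega ^+ 2 <= Y omega) -> L1 Y -> L2 X.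
Proof.
move=> mX XY iY; split => //; apply: L1_le iY; first exact: measurable_funX.
by move=> omega; rewrite ger0_norm ?sqr_ge0.
Qed.

Lemma L2_add X Y : L2 X -> L2 Y -> L2 (fun omega => X omega + Y omega).
Proof.
move=> [mX iX] [mY iY].
apply: (@L2_le _ (fun w => 2 * X w ^+ 2 + 2 * Y w ^+ 2)).
- exact: measurable_funD.
- by move=> w; have := sqr_ge0 (X w - Y w); nra.
- by apply: L1_add; exact: L1_scale.
Qed.

Lemma L2_scale (c : R) X : L2 X -> L2 (fun omega => c * X omega).
Proof.
move=> [mX iX]; apply: (@L2_le _ (fun w => c ^+ 2 * X w ^+ 2)).
- by apply: measurable_funM.
- by move=> w; rewrite exprMn.
- exact: L1_scale.
Qed.

Lemma L2_sum (I : Type) (r : seq I) (p : pred I) (X : I -> Omega -> R) :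
  (forall i, p i -> L2 (X i)) -> L2 (fun omega => \sum_(i <- r | p i) X i omega).
Proof.
move=> iX; elim: r => [|i r ih].
  under eq_fun do rewrite big_nil.
  by split; [exact: measurable_cst|exact: L1_cst].
case: (boolP (p i)) => pi.
  by under eq_fun do rewrite big_cons pi; apply: L2_add ih; exact: iX.
by under eq_fun do rewrite big_cons (negPf pi).
Qed.

Lemma L2_mul X Y : L2 X -> L2 Y -> L1 (fun omega => X omega * Y omega).
Proof.
move=> [mX iX] [mY iY]; apply: (@L1_le _ (fun w => X w ^+ 2 + Y w ^+ 2)).
- exact: measurable_funM.
- move=> w; rewrite ler_norml.
  have := sqr_ge0 (X w - Y w); have := sqr_ge0 (X w + Y w).
  have := sqr_ge0 (X w); have := sqr_ge0 (Y w).
  by move=> *; apply/andP; split; nra.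
- exact: L1_add.
Qed.

Lemma L2_L1 X : L2 X -> L1 X.
Proof.
move=> iX; have : L1 (fun w => X w * 1).
  apply: L2_mul iX _; split; first exact: measurable_cst.
  exact: L1_cst.
by under eq_fun do rewrite mulr1.
Qed.

Lemma L1_EFin X : L1 X ->
  (\int[P]_omega (X omega)%:E = (\int[P]_omega X omega)%R%:E)%E.
Proof. by move=> iX; rewrite fineK//; exact: integrable_fin_num. Qed.

End square_integrable.

(** * Borel measurability of functions of row vectors *)

Section borel_rV.
Variables (R : realType) (k : nat).
Local Notation W := (borel_rV R k).

Lemma continuous_measurable_borel_rV (f : 'rV[R]_k -> R) :
  continuous f -> measurable_fun [set: W] (f : W -> R).
Proof.
move=> /continuousP cf; apply: (measurability _ (RGenOpens.measurableE R)).
move=> _ [_ [a [b ->] <-]]; rewrite setTI.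
by apply: sub_sigma_algebra; exact/cf/interval_open.
Qed.

Lemma measurable_coord i : measurable_fun [set: W] (fun x : W => x 0 i : R).
Proof.
apply: (@continuous_measurable_borel_rV (fun x => x 0 i)).
exact: coord_continuous.
Qed.

End borel_rV.

(** * One round of federated averaging *)

Lemma differentiable_global_loss (R : realType) (N k : nat) (alpha : 'I_N -> R)
    (loss : 'I_N -> 'rV[R]_k -> R) y :
  (forall n y, differentiable (loss n) y) ->
  differentiable (global_loss alpha loss) y.
Proof.
move=> dl; rewrite (_ : global_loss alpha loss =
    \sum_(n < N) (fun y => alpha n *: loss n y)); last first.
  by apply/funext => z; rewrite fct_sumE.
by apply: differentiable_sum => n; exact: differentiableZ.
Qed.

Lemma gradient_global_loss (R : realType) (N k : nat) (alpha : 'I_N -> R)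
    (loss : 'I_N -> 'rV[R]_k -> R) y :
  (forall n y, differentiable (loss n) y) ->
  gradient (global_loss alpha loss) y = \sum_n alpha n *: gradient (loss n) y.
Proof.
move=> dl; apply/rowP => i; rewrite summxE mxE.
rewrite (_ : global_loss alpha loss =
    \sum_(n < N) (fun y => alpha n *: loss n y)); last first.
  by apply/funext => z; rewrite fct_sumE.
have dln n := @diff_derivable _ _ _ _ _ (delta_mx 0 i) (dl n y).
rewrite derive_sum => [|n]; last exact: derivableZ.
by apply: eq_bigr => n _; rewrite deriveZ// !mxE.
Qed.

(** Each of the [N ^ 2] products [<a n, a m>] is at most [(|a n|^2 + |a m|^2) / 2 <= C]. *)
Lemma dotr_mean_le (R : realType) (k N : nat) (a : 'I_N -> 'rV[R]_k) (C : R) :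
  (0 < N)%N -> (forall n, dotr (a n) (a n) <= C) ->
  dotr (N%:R^-1 *: \sum_n a n) (N%:R^-1 *: \sum_n a n) <= C.
Proof.
move=> N0 aC; have N0' : 0 < N%:R :> R by rewrite ltr0n.
rewrite dotrZl dotrZr mulrA -invfM mulrC ler_pdivrMr ?mulr_gt0//.
rewrite dotr_suml; under eq_bigr do rewrite dotr_sumr.
apply: (@le_trans _ _ (\sum_(n < N) \sum_(m < N) C)).
  apply: ler_sum => n _; apply: ler_sum => m _.
  have := dotr_ge0 (a n - a m); have := aC n; have := aC m.
  by rewrite dotrDl !dotrDr !dotrNl !dotrNr (dotrC (a m) (a n)); lra.
by rewrite !sumr_const !card_ord -mulrnA -(mulr_natr C) natrM.
Qed.

Section noise.
Context (R : realType) (k N : nat) (d dX : measure_display)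
  (Omega : measurableType d) (Xi : measurableType dX).
Local Notation W := (borel_rV R k).
Variables (P : probability Omega R) (nu : 'I_N -> probability Xi R).
Variables (x : Omega -> W) (xloc : 'I_N -> Omega -> W).
Variable xi : 'I_N -> Omega -> Xi.
Hypothesis hx : measurable_fun [set: Omega] x.
Hypothesis hxloc : forall n, measurable_fun [set: Omega] (xloc n).
Hypothesis hxi : forall n, measurable_fun [set: Omega] (xi n).
Hypothesis hlaw : forall n C, measurable C -> P (xi n @^-1` C) = nu n C.
Hypothesis hfresh : fresh_given P (models x xloc) xi.

Let cylinder (A : option 'I_N -> set W) (C : 'I_N -> set Xi) : set Omega :=
  (\bigcap_(j in [set: option 'I_N]) models x xloc j @^-1` A j) `&`
  (\bigcap_(i in [set: 'I_N]) xi i @^-1` C i).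

(* A pi-system generating the sigma-algebra of everything known in the round
   except the batch of client n. *)
Definition past n : set (set Omega) :=
  [set S | exists A C, [/\ forall j, measurable (A j),
    forall i, measurable (C i), C n = setT & S = cylinder A C]].

Let measurable_models o : measurable_fun [set: Omega] (models x xloc o).
Proof. by case: o => [n|] /=; [exact: hxloc|exact: hx]. Qed.

Lemma past_measurable n : past n `<=` measurable.
Proof.
move=> _ [A [C [mA mC _ ->]]]; apply: measurableI.
- apply: fin_bigcap_measurable => [|j _]; first exact: finite_finset.
  by rewrite -[X in measurable X]setTI; exact: measurable_models.
- apply: fin_bigcap_measurable => [|i _]; first exact: finite_finset.
  by rewrite -[X in measurable X]setTI; exact: hxi.
Qed.

Lemma past_setI n : setI_closed (past n).
Proof.
move=> _ _ [A [C [mA mC Cn ->]]] [A' [C' [mA' mC' Cn' ->]]].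
exists (fun j => A j `&` A' j), (fun i => C i `&` C' i); split.
- by move=> j; exact: measurableI.
- by move=> i; exact: measurableI.
- by rewrite Cn Cn' setIid.
- by rewrite /cylinder setIACA -!bigcapI.
Qed.

Lemma past_setT n : past n setT.
Proof.
exists (fun=> setT), (fun=> setT); split=> //.
by apply/seteqP; split=> // w _; split.
Qed.

(** A cylinder of [past n] leaves the batch of client [n] free, so the event on that batch fills the
    empty slot and the result is again a cylinder, to which freshness applies. *)
Lemma past_indep n S B : past n S -> measurable B ->
  P (S `&` xi n @^-1` B) = (P S * nu n B)%E.
Proof.
move=> [A [C [mA mC Cn ->]]] mB.
pose C' i := if i == n then B else C i.
have mC' i : measurable (C' i) by rewrite /C'; case: ifP.
have -> : cylinder A C `&` xi n @^-1` B = cylinder A C'.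
  rewrite /cylinder -setIA; congr (_ `&` _); apply/seteqP; split=> w /=.
    by move=> [wC wB] i _; rewrite /C'; case: eqP => [->//|_]; exact: wC.
  move=> wC; split; last by have := wC n I; rewrite /C' eqxx.
  move=> i _; have := wC i I; rewrite /C'; case: eqP => [->|//].
  by rewrite Cn.
rewrite /cylinder !hfresh//.
rewrite (bigD1 n)//= [in RHS](bigD1 n)//= Cn preimage_setT probability_setT.
rewrite mul1e /C' eqxx hlaw// muleCA muleC; congr (_ * _ * _)%E.
by apply: eq_bigr => i /negPf ->.
Qed.

Lemma past_measurable_models n o : measurable_fun
  [set: g_sigma_algebraType (past n)]
  (models x xloc o : g_sigma_algebraType (past n) -> W).
Proof.
move=> _ B mB; rewrite setTI; apply: sub_sigma_algebra.
exists (fun j => if j == o then B else setT), (fun=> setT); split=> //.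
  by move=> j; case: ifP.
apply/seteqP; split=> [w wB|w [/(_ o I)]]; last by rewrite /= eqxx.
by split=> // j _; rewrite /=; case: eqP => [->|].
Qed.

Lemma past_measurable_batch n m : m != n -> measurable_fun
  [set: g_sigma_algebraType (past n)]
  (xi m : g_sigma_algebraType (past n) -> Xi).
Proof.
move=> mn _ B mB; rewrite setTI; apply: sub_sigma_algebra.
exists (fun=> setT), (fun i => if i == m then B else setT); split=> //.
- by move=> i; case: ifP.
- by rewrite eq_sym (negPf mn).
- apply/seteqP; split=> [w wB|w [_ /(_ m I)]]; last by rewrite /= eqxx.
  by split=> // j _; rewrite /=; case: eqP => [->|].
Qed.

Lemma past_measurable_fun n (V : Omega -> R) :
  measurable_fun [set: g_sigma_algebraType (past n)]
    (V : g_sigma_algebraType (past n) -> R) ->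
  measurable_fun [set: Omega] V.
Proof.
move=> mV _ B mB; have := mV measurableT B mB.
by apply: smallest_sub;
  [exact: sigma_algebra_measurable|exact: past_measurable].
Qed.

Variables (loss : 'I_N -> 'rV[R]_k -> R) (g : 'I_N -> W -> Xi -> W).
Variable sigma : R.
Hypothesis hg : forall n, measurable_fun [set: W * Xi] (fun p => g n p.1 p.2).
Hypothesis hunbiased : forall n y i,
  ('E_(nu n)[fun b => (g n y b 0 i)%R] = (gradient (loss n) y 0 i)%R%:E)%E.
Hypothesis hvar : forall n y,
  ('E_(nu n)[fun b => (frobenius_norm (g n y b - gradient (loss n) y) ^+ 2)%R]
    <= (sigma ^+ 2)%R%:E)%E.

(** By unbiasedness the coordinate is an integral over the batch with [y] as parameter; Tonelli,
    applied to the positive and negative parts, makes it measurable in [y]. *)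
Lemma measurable_gradient n i :
  measurable_fun [set: W] (fun y : W => gradient (loss n) y 0 i : R).
Proof.
apply/measurable_EFinP.
have -> : EFin \o (fun y : W => gradient (loss n) y 0 i) =
    fun y => (\int[nu n]_b (g n y b 0 i)%:E)%E.
  by apply/funext => y; rewrite /= -hunbiased unlock.
have mg : measurable_fun [set: W * Xi]
    (fun p : W * Xi => (g n p.1 p.2 0 i)%:E : \bar R).
  apply/measurable_EFinP.
  exact: (measurableT_comp (measurable_coord i) (hg n)).
under eq_fun do rewrite integralE.
apply: emeasurable_funB.
- have := @measurable_fun_fubini_tonelli_F _ _ _ _ _ (nu n) _
    (measurable_funepos mg) (fun z => funepos_ge0 _ z).
  apply: eq_measurable_fun => y _; apply: eq_integral => b _.
  by rewrite !funeposE.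
- have := @measurable_fun_fubini_tonelli_F _ _ _ _ _ (nu n) _
    (measurable_funeneg mg) (fun z => funeneg_ge0 _ z).
  apply: eq_measurable_fun => y _; apply: eq_integral => b _.
  by rewrite !funenegE.
Qed.

Definition noise n (omega : Omega) : 'rV[R]_k :=
  (g n (xloc n omega) (xi n omega) : 'rV[R]_k)
    - gradient (loss n) (xloc n omega).

Let centered n i (p : W * Xi) : R :=
  (g n p.1 p.2 - gradient (loss n) p.1 : 'rV[R]_k) 0 i.

Let measurable_centered n i : measurable_fun [set: W * Xi] (centered n i).
Proof.
rewrite (_ : centered n i =
  (fun p => g n p.1 p.2 0 i - gradient (loss n) p.1 0 i)); last first.
  by apply/funext => p; rewrite /centered !mxE.
apply: measurable_funB.
- exact: (measurableT_comp (measurable_coord i) (hg n)).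
- exact: (measurableT_comp (measurable_gradient n i) measurable_fst).
Qed.

Let measurable_centered_dotr n : measurable_fun [set: W * Xi]
  (fun p : W * Xi => \sum_i centered n i p ^+ 2).
Proof. by apply: measurable_sum => i; exact: measurable_funX. Qed.

Let frobenius_centered n y b :
  frobenius_norm (g n y b - gradient (loss n) y : 'rV[R]_k) ^+ 2 =
  \sum_i centered n i (y, b) ^+ 2.
Proof. by rewrite sqr_frobenius_norm big_ord1. Qed.

Let L1_centered_dotr n y :
  L1 (nu n) (fun b => \sum_i centered n i (y, b) ^+ 2).
Proof.
apply: (@L1_bounded _ _ _ _ _ (sigma ^+ 2)).
- exact: (measurableT_comp (measurable_centered_dotr n) (pair1_measurable y)).
- by move=> b; apply: sumr_ge0 => i _; exact: sqr_ge0.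
- apply: le_trans (hvar n y); rewrite expectation.unlock.
  by under [leRHS]eq_integral do rewrite frobenius_centered.
Qed.

Let L2_centered n y i : L2 (nu n) (fun b => centered n i (y, b)).
Proof.
apply: L2_le (L1_centered_dotr n y).
  exact: (measurableT_comp (measurable_centered n i) (pair1_measurable y)).
move=> b; rewrite (bigD1 i)//= lerDl.
by apply: sumr_ge0 => j _; exact: sqr_ge0.
Qed.

Let integral_centered n y i :
  (\int[nu n]_b (centered n i (y, b))%:E = 0)%E.
Proof.
have iG : L1 (nu n) (fun b => gradient (loss n) y 0 i) by exact: L1_cst.
(* The variance bound makes the centred gradient integrable, and adding back a constant gives the
   gradient itself, so its expectation may be split. *)
have ig : L1 (nu n) (fun b => g n y b 0 i).
  have := L1_add (L2_L1 (L2_centered n y i)) iG.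
  by under eq_fun do rewrite /centered !mxE subrK.
rewrite (L1_EFin (L2_L1 (L2_centered n y i))).
have -> : \int[nu n]_b centered n i (y, b) =
    \int[nu n]_b g n y b 0 i - \int[nu n]_b gradient (loss n) y 0 i.
  rewrite -(RintegralB measurableT ig iG).
  by apply: eq_Rintegral => b _; rewrite /centered !mxE.
rewrite [X in _ - X]Rintegral_cst//.
rewrite [X in fine X](_ : _ = 1%E) ?mulr1; last exact: probability_setT.
have := hunbiased n y i; rewrite unlock (L1_EFin ig) => -[->].
by rewrite subrr.
Qed.

Lemma measurable_noise n i : measurable_fun [set: Omega] (fun w => noise n w 0 i).
Proof.
exact: (measurableT_comp (measurable_centered n i)
  (measurable_fun_pair (hxloc n) (hxi n))).
Qed.

Lemma past_measurable_noise n m i : m != n ->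
  measurable_fun [set: g_sigma_algebraType (past n)]
    (fun w : g_sigma_algebraType (past n) => noise m w 0 i : R).
Proof.
move=> mn.
have mp : measurable_fun [set: g_sigma_algebraType (past n)]
    (fun w : g_sigma_algebraType (past n) => (xloc m w, xi m w) : W * Xi).
  apply: measurable_fun_pair.
    exact: (@past_measurable_models n (Some m)).
  exact: past_measurable_batch mn.
exact: (measurableT_comp (measurable_centered m i) mp).
Qed.

(** The local model belongs to the past, so the batch can be integrated out first; the inner
    integral is the variance at a fixed model. *)
Lemma noise_variance n :
  (\int[P]_w (dotr (noise n w) (noise n w))%:E <= (sigma ^+ 2)%:E)%E.
Proof.
pose Phi (p : g_sigma_algebraType (past n) * Xi) : \bar R :=
  (\sum_i centered n i (xloc n p.1, p.2) ^+ 2)%:E.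
have -> : (\int[P]_w (dotr (noise n w) (noise n w))%:E =
    \int[P]_w Phi (w, xi n w))%E.
  by apply: eq_integral => w _; congr EFin; apply: eq_bigr => i _; rewrite expr2.
rewrite (ge0_integral_indep (hxi n) (@past_measurable n) (@past_setI n)
  (past_setT n) (@past_indep n))/=; last 2 first.
- apply/measurable_EFinP; apply: (measurableT_comp (measurable_centered_dotr n)).
  apply: measurable_fun_pair measurable_snd.
  exact: (measurableT_comp (@past_measurable_models n (Some n)) measurable_fst).
- by move=> z; rewrite lee_fin; apply: sumr_ge0 => i _; exact: sqr_ge0.
(* Writing the bound as the integral of a constant reduces the claim to a comparison for each
   outcome. *)
rewrite -[leRHS]mule1 -(probability_setT P) -integral_cst//.
apply: ge0_le_integral => //.
- move=> w _; apply: integral_ge0 => b _; rewrite lee_fin.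
  by apply: sumr_ge0 => i _; exact: sqr_ge0.
- apply: (@measurableT_comp _ _ _ _ _ _
    (fun y : W => \int[nu n]_b (\sum_i centered n i (y, b) ^+ 2)%:E)%E) (hxloc n).
  apply: (measurable_fun_fubini_tonelli_F (m2 := nu n)
    (fun p => (\sum_i centered n i p ^+ 2)%:E)).
    exact/measurable_EFinP.
  by move=> z; rewrite lee_fin; apply: sumr_ge0 => i _; exact: sqr_ge0.
- move=> w _; apply: le_trans (hvar n (xloc n w)).
  rewrite expectation.unlock.
  by under [leRHS]eq_integral do rewrite frobenius_centered.
Qed.

Lemma L1_noise n : L1 P (fun w => dotr (noise n w) (noise n w)).
Proof.
apply: L1_bounded (noise_variance n) => [|w]; last exact: dotr_ge0.
by apply: measurable_sum => i; apply: measurable_funM; exact: measurable_noise.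
Qed.

Lemma L2_noise n i : L2 P (fun w => noise n w 0 i).
Proof.
apply: L2_le (L1_noise n); first exact: measurable_noise.
by move=> w; exact: sqr_le_dotr.
Qed.

(** With the past frozen, [V] is a constant factor and the integral of the noise over the batch is
    zero. *)
Lemma noise_orthogonal n i (V : Omega -> R) :
  measurable_fun [set: g_sigma_algebraType (past n)]
    (V : g_sigma_algebraType (past n) -> R) ->
  L1 P (fun w => V w ^+ 2) ->
  \int[P]_w (V w * noise n w 0 i) = 0.
Proof.
move=> mV iV.
have i1 : L1 P (fun w => V w * noise n w 0 i).
  by apply: L2_mul (L2_noise n i); split=> //; exact: past_measurable_fun mV.
apply/EFin_inj; rewrite -(L1_EFin i1).
pose Phi (p : g_sigma_algebraType (past n) * Xi) : \bar R :=
  (V p.1 * centered n i (xloc n p.1, p.2))%:E.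
apply: (integral_indep_eq0 (nu := nu n) (Phi := Phi) (hxi n)
  (@past_measurable n) (@past_setI n) (past_setT n) (@past_indep n)) => //.
- apply/measurable_EFinP; apply: measurable_funM.
    exact: (measurableT_comp mV measurable_fst).
  apply: (measurableT_comp (measurable_centered n i)).
  apply: measurable_fun_pair measurable_snd.
  exact: (measurableT_comp (@past_measurable_models n (Some n)) measurable_fst).
- move=> w; rewrite /Phi/=; under eq_integral do rewrite EFinM.
  rewrite integralZl//; last exact: (L2_L1 (L2_centered n _ i)).
  by rewrite integral_centered mule0.
Qed.

(** * The descent inequality of one round and its expectation *)

Hypothesis hN : (0 < N)%N.
Variable alpha : 'I_N -> R.
Hypothesis halpha : forall n, alpha n = N%:R^-1.
Hypothesis hdiff : forall n y, differentiable (loss n) y.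
Let f := global_loss alpha loss.
Variables (eta beta Lstar C : R).
Hypotheses (heta : 0 < eta) (hbeta : 0 <= beta) (hstep : eta * beta <= 1).
Hypothesis hmin : forall y, Lstar <= f y.
Hypothesis hsmooth : forall y z,
  frobenius_norm (gradient f y - gradient f z) <= beta * frobenius_norm (y - z).
Hypothesis hgap : forall n w,
  dotr (gradient f (x w) - gradient (loss n) (xloc n w))
       (gradient f (x w) - gradient (loss n) (xloc n w)) <= C.

Let df y : differentiable f y.
Proof. exact: differentiable_global_loss. Qed.

Lemma past_measurable_global_gradient n i :
  measurable_fun [set: g_sigma_algebraType (past n)]
    (fun w : g_sigma_algebraType (past n) => gradient f (x w) 0 i : R).
Proof.
under eq_fun => w.
  rewrite /f gradient_global_loss// summxE; under eq_bigr do rewrite mxE.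
over.
apply: measurable_sum => m; apply: measurable_funM => //.
exact: (measurableT_comp (measurable_gradient m i)
  (@past_measurable_models n None)).
Qed.

Lemma past_measurable_local_gradient n m i :
  measurable_fun [set: g_sigma_algebraType (past n)]
    (fun w : g_sigma_algebraType (past n) =>
      gradient (loss m) (xloc m w) 0 i : R).
Proof.
exact: (measurableT_comp (measurable_gradient m i)
  (@past_measurable_models n (Some m))).
Qed.

Let mean (w : Omega) := \sum_n alpha n *: gradient (loss n) (xloc n w).
Let drift (w : Omega) := (eta ^+ 2 * beta) *: mean w - eta *: gradient f (x w).
(* The coefficient of the double sum sum_(n, m) <noise m, noise n> in the
   descent inequality; V n collects everything multiplying noise n except
   noise n itself, so that it does not depend on the batch of client n. *)
Let kappa := eta ^+ 2 * beta / 2 / N%:R ^+ 2.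
Let V n (w : Omega) : 'rV[R]_k :=
  N%:R^-1 *: drift w + kappa *: \sum_(m | m != n) noise m w.

Lemma L1_gradient : L1 P (fun w => f (x w) - Lstar) ->
  L1 P (fun w => dotr (gradient f (x w)) (gradient f (x w))).
Proof.
(* Any client will do here: it only names a sub-sigma-algebra for which the gradient is known to be
   measurable. *)
move=> fL; have n0 : 'I_N by case: (N) hN => // n _; exact: ord0.
apply: (@L1_le _ _ _ _ _ (fun w => 2 / eta * (f (x w) - Lstar))).
- apply: measurable_sum => i.
  have m := past_measurable_fun (@past_measurable_global_gradient n0 i).
  exact: measurable_funM.
- move=> w; rewrite ger0_norm ?dotr_ge0//.
  have eta2 : 0 < eta / 2 by rewrite divr_gt0.
  rewrite -(ler_pM2l eta2) mulrA (_ : eta / 2 * (2 / eta) = 1).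
    rewrite mul1r; exact: (sqr_gradient_le df hbeta hsmooth _ heta).
  by field; rewrite gt_eqF.
- exact: L1_scale.
Qed.

(** These are the two conditions of [noise_orthogonal]. Square-integrability comes from
    [L1_gradient] for the global gradient, from the gap bound for the local ones and from the
    variance for the other noises. *)
Let L2_V n i : L1 P (fun w => f (x w) - Lstar) ->
  measurable_fun [set: g_sigma_algebraType (past n)]
    (fun w : g_sigma_algebraType (past n) => V n w 0 i : R) /\
  L2 P (fun w => V n w 0 i).
Proof.
move=> /L1_gradient iD.
pose F (w : Omega) := N%:R^-1 * (eta ^+ 2 * beta *
      (\sum_m alpha m * gradient (loss m) (xloc m w) 0 i)
      + (- eta) * gradient f (x w) 0 i)
    + kappa * \sum_(m | m != n) noise m w 0 i.
have VF : (fun w => V n w 0 i) = F.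
  apply/funext => w; rewrite /V /drift /mean !(mxE, summxE) /F mulNr.
  under eq_bigr do rewrite mxE.
  by rewrite [gradient f _ 0 i]mxE.
suff : measurable_fun [set: g_sigma_algebraType (past n)]
    (F : g_sigma_algebraType (past n) -> R) /\ L2 P F by rewrite -VF.
split.
  apply: measurable_funD; apply: measurable_funM => //; last first.
    under eq_fun do rewrite big_mkcond.
    apply: measurable_sum => m; case: (boolP (m != n)) => // mn.
    exact: past_measurable_noise.
  apply: measurable_funD; apply: measurable_funM => //; last first.
    exact: past_measurable_global_gradient.
  apply: measurable_sum => m; apply: measurable_funM => //.
  exact: past_measurable_local_gradient.
have L2D : L2 P (fun w => gradient f (x w) 0 i).
  apply: L2_le iD; last by move=> w; exact: sqr_le_dotr.
  exact: past_measurable_fun (@past_measurable_global_gradient n i).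
apply: L2_add; apply: L2_scale; last by apply: L2_sum => m _; exact: L2_noise.
apply: L2_add; apply: L2_scale => //.
apply: L2_sum => m _; apply: L2_scale.
apply: (@L2_le _ _ _ _ _
  (fun w => 2 * dotr (gradient f (x w)) (gradient f (x w)) + 2 * C)).
- exact: past_measurable_fun (@past_measurable_local_gradient n m i).
- by move=> w; exact/sqr_coord_le/hgap.
- by apply: L1_add; [exact: L1_scale|exact: L1_cst].
Qed.

(** With [E] the averaged noise, this is [<drift, E> + eta^2 beta/2 |E|^2], the square being
    expanded over pairs of clients: off-diagonal pairs are absorbed in [V], the diagonal ones form
    the last sum. *)
Definition fluctuation (w : Omega) : R :=
  \sum_n dotr (V n w) (noise n w) + kappa * \sum_n dotr (noise n w) (noise n w).

Lemma L1_fluctuation : L1 P (fun w => f (x w) - Lstar) -> L1 P fluctuation.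
Proof.
move=> iF; apply: L1_add.
  apply: L1_sum => n; apply: L1_sum => i.
  by apply: L2_mul; [exact: (L2_V n i iF).2|exact: L2_noise].
by apply: L1_scale; apply: L1_sum => n; exact: L1_noise.
Qed.

(** Only the diagonal survives: [N] variances times [kappa], whose factor [1 / N^2] leaves the gain
    [1 / N] of averaging. *)
Lemma Rintegral_fluctuation : L1 P (fun w => f (x w) - Lstar) ->
  \int[P]_w fluctuation w <= eta ^+ 2 * beta * sigma ^+ 2 / (2 * N%:R).
Proof.
move=> iF.
have iVe n i : L1 P (fun w => V n w 0 i * noise n w 0 i).
  by apply: L2_mul; [exact: (L2_V n i iF).2|exact: L2_noise].
have iV n : L1 P (fun w => dotr (V n w) (noise n w)) by exact: L1_sum.
have ie : L1 P (fun w => \sum_n dotr (noise n w) (noise n w)).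
  by apply: L1_sum => n; exact: L1_noise.
rewrite (RintegralD measurableT (L1_sum _ iV) (L1_scale kappa ie)).
rewrite (Rintegral_sum _ iV) big1 => [|n _]; last first.
  rewrite (Rintegral_sum _ (iVe n)) big1// => i _.
  by apply: noise_orthogonal; [exact: (L2_V n i iF).1|exact: (L2_V n i iF).2.2].
rewrite add0r (RintegralZl kappa measurableT ie) (Rintegral_sum _ L1_noise).
apply: (@le_trans _ _ (kappa * \sum_(n < N) sigma ^+ 2)).
  apply: ler_wpM2l.
    by rewrite /kappa !divr_ge0 ?mulr_ge0 ?ler0n ?(ltW heta).
  apply: ler_sum => n _; rewrite -lee_fin -(L1_EFin (L1_noise n)).
  exact: noise_variance.
rewrite sumr_const card_ord -mulr_natr /kappa le_eqVlt; apply/orP; left.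
have N0 : N%:R != 0 :> R by rewrite pnatr_eq0 -lt0n.
by apply/eqP; field.
Qed.

(** With [m] the mean local gradient, the descent lemma yields [- eta <m, D>], which polarization
    turns into [eta/2 (|D - m|^2 - |D|^2 - |m|^2)]. *)
Lemma round_descent w :
  f ((x w : 'rV[R]_k)
     - eta *: \sum_n alpha n *: (g n (xloc n w) (xi n w) : 'rV[R]_k))
    + eta / 2 * dotr (gradient f (x w)) (gradient f (x w))
  <= f (x w) + eta / 2 * C + fluctuation w.
Proof.
have N0 : N%:R != 0 :> R by rewrite pnatr_eq0 -lt0n.
set D := gradient f (x w).
pose E := N%:R^-1 *: \sum_n noise n w.
have gE : \sum_n alpha n *: (g n (xloc n w) (xi n w) : 'rV[R]_k) = mean w + E.
  rewrite /mean /E scaler_sumr -big_split; apply: eq_bigr => n _.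
  by rewrite /= halpha -scalerDr addrC subrK.
(* As the equal weights sum to 1, the gap to the mean is the mean of the gaps. *)
have gap : dotr (D - mean w) (D - mean w) <= C.
  have -> : D - mean w =
      N%:R^-1 *: \sum_n (D - gradient (loss n) (xloc n w)).
    rewrite sumrB sumr_const card_ord scalerBr -[D *+ _]scaler_nat scalerA mulVf//.
    rewrite scale1r scaler_sumr; congr (_ - _).
    by apply: eq_bigr => n _; rewrite halpha.
  by apply: dotr_mean_le => // n; exact: hgap.
have WE : fluctuation w =
    dotr (drift w) E + eta ^+ 2 * beta / 2 * dotr E E.
  have -> : fluctuation w = \sum_n (N%:R^-1 * dotr (drift w) (noise n w)
      + kappa * \sum_m dotr (noise m w) (noise n w)).
    rewrite /fluctuation mulr_sumr -big_split; apply: eq_bigr => n _ /=.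
    rewrite dotrDl !dotrZl [in RHS](bigD1 n)//= -addrA; congr (_ + _).
    rewrite -mulrDr addrC; congr (_ * (_ + _)).
    by apply: (big_morph (fun a => dotr a (noise n w))) => [a b|];
      [exact: dotrDl|rewrite /dotr big1// => i _; rewrite mxE mul0r].
  rewrite big_split /= -!mulr_sumr -dotr_sumr /E dotrZr; congr (_ + _).
  under eq_bigr do rewrite -dotr_suml.
  by rewrite -dotr_sumr dotrZl dotrZr /kappa; field.
have := descent df hbeta hsmooth (x w) (- (eta *: (mean w + E))).
rewrite gE WE -/D /drift -/D; clear gE WE; clearbody E.
rewrite !(dotrDl, dotrDr, dotrNl, dotrNr, dotrZl, dotrZr).
move: gap; rewrite !(dotrDl, dotrDr, dotrNl, dotrNr).
rewrite (dotrC D (mean w)) (dotrC E D) (dotrC E (mean w)).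
(* The step-size condition lets [- eta/2 |m|^2] absorb the quadratic term [eta^2 beta/2 |m|^2]. *)
have : eta * (eta * beta * dotr (mean w) (mean w)) <=
    eta * dotr (mean w) (mean w).
  by rewrite ler_pM2l// ler_piMl// dotr_ge0.
set mm := dotr (mean w) _; set md := dotr (mean w) D; set dd := dotr D D.
set me := dotr (mean w) E; set de := dotr D E; set ee := dotr E E.
move=> h1 h2 h3.
have : eta * (dd - md - (md - mm)) <= eta * C by rewrite ler_pM2l//; lra.
by move: h1 h3; lra.
Qed.

Lemma one_round : L1 P (fun w => f (x w) - Lstar) ->
  L1 P (fun w => dotr (gradient f (x w)) (gradient f (x w))) /\
  exists fl : Omega -> R,
    [/\ L1 P fl, \int[P]_w fl w <= eta ^+ 2 * beta * sigma ^+ 2 / (2 * N%:R)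
      & forall w, f ((x w : 'rV[R]_k)
     - eta *: \sum_n alpha n *: (g n (xloc n w) (xi n w) : 'rV[R]_k))
    + eta / 2 * dotr (gradient f (x w)) (gradient f (x w))
  <= f (x w) + eta / 2 * C + fl w].
Proof.
move=> iF; split; first exact: L1_gradient.
exists fluctuation; split; [exact: L1_fluctuation|exact: Rintegral_fluctuation|].
exact: round_descent.
Qed.

End noise.

(** * Summation over the rounds *)

Lemma telescoping_average (R : realType) (a Q : nat -> R) (eta K : R) (T : nat) :
  0 < eta -> (0 < T)%N ->
  (forall t, (1 <= t < T)%N -> a t.+1 + eta / 2 * Q t <= a t + K) ->
  eta / 2 * Q T <= a T + K ->
  T%:R^-1 * \sum_(1 <= t < T.+1) Q t <= 2 / (eta * T%:R) * a 1%N + 2 / eta * K.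
Proof.
move=> eta0; case: T => // T _ aQ aT.
(* After the case split the horizon is [T.+1]. The rounds before it telescope; the last one is added
   in [S], with no successor term on the left. *)
have partial j : (j <= T)%N ->
    a j.+1 + eta / 2 * \sum_(1 <= t < j.+1) Q t <= a 1%N + j%:R * K.
  elim: j => [_|j ih jT]; first by rewrite big_geq// mulr0 mul0r.
  rewrite -[j.+1%:R]natr1 mulrDl mul1r big_nat_recr//= mulrDr.
  by have := ih (ltnW jT); have := aQ j.+1 jT; lra.
have T0 : 0 < T.+1%:R :> R by rewrite ltr0n.
have S : eta / 2 * \sum_(1 <= t < T.+2) Q t <= a 1%N + T.+1%:R * K.
  rewrite -[T.+1%:R]natr1 mulrDl mul1r big_nat_recr//= mulrDr.
  by have := partial T (leqnn T); lra.
have c0 : 0 < eta / 2 * T.+1%:R by rewrite mulr_gt0// divr_gt0.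
rewrite -(ler_pM2l c0); move: S; set s := \sum_(_ <= _ < _) _.
have -> : eta / 2 * T.+1%:R * (T.+1%:R^-1 * s) = eta / 2 * s.
  by field; rewrite gt_eqF.
have -> : eta / 2 * T.+1%:R * (2 / (eta * T.+1%:R) * a 1%N + 2 / eta * K) =
    a 1%N + T.+1%:R * K.
  by field; rewrite !gt_eqF.
by [].
Qed.

Theorem mainTheorem2 (R : realType)
  (* model: L layers, layer l of size h l x w l; LoRA rank r *)
  (L r : nat) (h w : 'I_L -> nat)
  (hr : forall l, (r <= minn (h l) (w l))%N)
  (* N = |S| clients, local datasets, weights, losses *)
  (N : nat) (hN : (0 < N)%N)
  (Z : Type) (D : 'I_N -> seq Z)
  (hD : forall n m, size (D n) = size (D m))
  (alpha : 'I_N -> R) (halpha : forall n, alpha n = N%:R^-1)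
  (loss : 'I_N -> weights R h w -> R)
  (hdiff : forall n x, differentiable (loss n) x)
  (Lstar : R) (hLstar : is_min_value (global_loss alpha loss) Lstar)
  (eta beta sigma M : R) (heta : 0 < eta) (hbeta : 0 <= beta)
  (hstep : eta * beta <= 1)
  (* (1) smoothness *)
  (hsmooth : forall x y,
     frobenius_norm (gradient (global_loss alpha loss) x
                     - gradient (global_loss alpha loss) y)
     <= beta * frobenius_norm (x - y))
  (* random batches: nu n (D n) is the law of a batch of client n given D n *)
  (dX : measure_display) (Xi : measurableType dX)
  (nu : 'I_N -> seq Z -> probability Xi R)
  (g : 'I_N -> weights R h w -> Xi -> weights R h w)
  (hg : forall n, measurable_fun [set: borel_rV R (\sum_l h l * w l)%N * Xi]
     (fun p => g n p.1 p.2 : borel_rV R (\sum_l h l * w l)%N))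
  (* (2) unbiased gradient, coordinatewise *)
  (hunbiased : forall n x i,
     ('E_(nu n (D n))[fun b => (g n x b 0 i)%R] = (gradient (loss n) x 0 i)%R%:E)%E)
  (* (3) bounded variance *)
  (hvar : forall n x,
     ('E_(nu n (D n))[fun b =>
         (frobenius_norm (g n x b - gradient (loss n) x) ^+ 2)%R]
      <= (sigma ^+ 2)%R%:E)%E)
  (* the training process, rounds t = 1, ..., T *)
  (T : nat) (hT : (0 < T)%N)
  (d : measure_display) (Omega : measurableType d) (P : probability Omega R)
  (x : nat -> Omega -> weights R h w)
  (xloc : 'I_N -> nat -> Omega -> weights R h w)
  (xi : 'I_N -> nat -> Omega -> Xi)
  (hx : forall t, (1 <= t <= T)%N ->
     measurable_fun [set: Omega] (x t : Omega -> borel_rV R _))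
  (hxloc : forall n t, (1 <= t <= T)%N ->
     measurable_fun [set: Omega] (xloc n t : Omega -> borel_rV R _))
  (hxi : forall n t, (1 <= t <= T)%N -> measurable_fun [set: Omega] (xi n t))
  (hlaw : forall n t, (1 <= t <= T)%N -> forall C, measurable C ->
     P (xi n t @^-1` C) = nu n (D n) C)
  (hfresh : forall t, (1 <= t <= T)%N ->
     @fresh_given _ _ _ Omega R P (borel_rV R (\sum_l h l * w l)%N) Xi _ _
       (models (x t) (fun n => xloc n t)) (fun n => xi n t))
  (hlora : forall n t, (1 <= t <= T)%N -> forall omega,
     lora_model r (x t omega) (xloc n t omega))
  (hupdate : forall t, (1 <= t <= T)%N -> forall omega,
     x t.+1 omega = x t omega
       - eta *: \sum_n alpha n *: g n (xloc n t omega) (xi n t omega))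
  (* singular value decomposition of the gradient of the central model *)
  (s : nat -> Omega -> forall l, 'I_(minn (h l) (w l)) -> R)
  (u : nat -> Omega -> forall l, 'I_(minn (h l) (w l)) -> 'cV[R]_(h l))
  (v : nat -> Omega -> forall l, 'I_(minn (h l) (w l)) -> 'cV[R]_(w l))
  (hsvd : forall t, (1 <= t <= T)%N -> forall omega l,
     is_svd (layer (gradient (global_loss alpha loss) (x t omega)) l)
       (s t omega l) (u t omega l) (v t omega l))
  (* (4) bounded gradient *)
  (hM : forall t, (1 <= t <= T)%N -> forall omega l i, s t omega l i <= M)
  (* the central-local gap is the low-rank approximation error *)
  (hgap : forall n t, (1 <= t <= T)%N -> forall omega l,
     layer (gradient (global_loss alpha loss) (x t omega)
            - gradient (loss n) (xloc n t omega)) l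
     = svd_sum (s t omega l) (u t omega l) (v t omega l)
       - svd_trunc r (s t omega l) (u t omega l) (v t omega l)) :
  ((T%:R^-1)%R%:E *
     (\sum_(1 <= t < T.+1)
        'E_P[fun omega =>
          (frobenius_norm (gradient (global_loss alpha loss) (x t omega)) ^+ 2)%R])
   <= (2 / (eta * T%:R))%R%:E *
        'E_P[fun omega => (global_loss alpha loss (x 1%N omega) - Lstar)%R]
      + (eta * beta * sigma ^+ 2 / N%:R)%R%:E
      + (M ^+ 2 * ((\sum_l minn (h l) (w l))%:R - (L * r)%:R))%R%:E)%E.
Proof.
set f := global_loss alpha loss.
set C := M ^+ 2 * _.
have gap n t : (1 <= t <= T)%N -> forall omega,
    dotr (gradient f (x t omega) - gradient (loss n) (xloc n t omega))
         (gradient f (x t omega) - gradient (loss n) (xloc n t omega)) <= C.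
  move=> tT omega; rewrite -sqr_frobenius_norm_dotr.
  by apply: (sqr_frobenius_norm_lora_gap hr (hsvd t tT omega) (hM t tT omega));
    exact: hgap.
have fmin y : Lstar <= f y by exact: hLstar.2.
pose subopt t omega := f (x t omega) - Lstar.
pose q t omega := dotr (gradient f (x t omega)) (gradient f (x t omega)).
have subopt_ge0 t omega : 0 <= subopt t omega by rewrite subr_ge0.
have msubopt t : (1 <= t <= T)%N -> measurable_fun [set: Omega] (subopt t).
  move=> tT; apply: measurable_funB => //.
  apply: (measurableT_comp _ (hx t tT)).
  apply: continuous_measurable_borel_rV => y.
  exact/differentiable_continuous/differentiable_global_loss.
pose s0 := eta ^+ 2 * beta * sigma ^+ 2 / (2 * N%:R).
have step t : (1 <= t <= T)%N -> L1 P (subopt t) -> L1 P (q t) /\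
    exists fl : Omega -> R, [/\ L1 P fl, \int[P]_omega fl omega <= s0 &
      forall omega, subopt t.+1 omega + eta / 2 * q t omega <=
        subopt t omega + eta / 2 * C + fl omega].
  move=> tT iZ.
  have [iq [fl [ifl fls flE]]] := one_round (hx t tT) (fun n => hxloc n t tT)
    (fun n => hxi n t tT) (fun n => hlaw n t tT) (hfresh t tT) hg hunbiased hvar
    hN halpha hdiff heta hbeta hstep fmin hsmooth (fun n => gap n t tT) iZ.
  split=> //; exists fl; split=> // omega.
  have := flE omega; rewrite /subopt hupdate// /q -/f.
  set y := f _; set p := dotr _ _; set z := f _; move=> fly.
  by lra.
rewrite (_ : (\sum_(1 <= t < T.+1) _)%E =
    (\sum_(1 <= t < T.+1) \int[P]_omega (q t omega)%:E)%E); last first.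
  apply: eq_bigr => t _; rewrite expectation.unlock.
  apply: eq_integral => omega _.
  by rewrite sqr_frobenius_norm_dotr.
rewrite (_ : 'E_P[_]%E = (\int[P]_omega (subopt 1%N omega)%:E)%E); last first.
  by rewrite expectation.unlock.
have c0 : 0 < 2 / (eta * T%:R) by rewrite divr_gt0// mulr_gt0// ltr0n.
(* If the initial gap has infinite expectation, its positive coefficient makes the right-hand side
   infinite. *)
have [Zoo|iZ1] := eqVneq (\int[P]_omega (subopt 1%N omega)%:E)%E +oo%E.
  by rewrite Zoo gt0_muley ?lte_fin// !addye// leey.
have T1 : (1 <= 1 <= T)%N by [].
(* The round inequality dominates the next suboptimality by integrable terms of the current
   round. *)
have iZ t : (1 <= t <= T)%N -> L1 P (subopt t).
  elim: t => [//|[|t] ih] tT.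
    apply/integrableP; split; first exact/measurable_EFinP/msubopt.
    by under eq_integral do rewrite gee0_abs ?lee_fin//; rewrite ltey.
  have tT' : (1 <= t.+1 <= T)%N by case/andP: tT => _ /ltnW.
  have [iq [fl [ifl _ flE]]] := step _ tT' (ih tT').
  apply: (@L1_le _ _ _ _ _
    (fun omega => subopt t.+1 omega + eta / 2 * C + fl omega)).
  - exact: msubopt.
  - move=> omega; rewrite ger0_norm//; apply: le_trans (flE omega).
    by rewrite lerDl mulr_ge0 ?dotr_ge0 ?divr_ge0// ltW.
  - by apply: L1_add => //; apply: L1_add; [exact: ih|exact: L1_cst].
have iq t : (1 <= t <= T)%N -> L1 P (q t).
  by move=> tT; have [] := step _ tT (iZ _ tT).
(* The cost of one round; multiplied by [2 / eta] it becomes [C + eta beta sigma^2 / N]. *)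
pose K := eta / 2 * C + s0.
(* [Y] stands for the next suboptimality when [t < T] and for 0 when [t = T], because measurability
   of the central model is assumed only up to round [T]. *)
have upper t : (1 <= t <= T)%N -> forall Y : Omega -> R, L1 P Y ->
    (forall omega, Y omega <= subopt t.+1 omega) ->
    \int[P]_omega Y omega + eta / 2 * \int[P]_omega q t omega <=
    \int[P]_omega subopt t omega + K.
  move=> tT Y iY YZ; have [_ [fl [ifl fls flE]]] := step _ tT (iZ _ tT).
  have iq2 := L1_scale (eta / 2) (iq _ tT).
  have iC := L1_cst P (eta / 2 * C).
  have iZC := L1_add (iZ _ tT) iC.
  rewrite -(RintegralZl (eta / 2) measurableT (iq _ tT)).
  rewrite -(RintegralD measurableT iY iq2).
  apply: (@le_trans _ _ (\int[P]_omega (subopt t omega + eta / 2 * C + fl omega))).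
    apply: le_Rintegral => //; [exact: L1_add|exact: L1_add|move=> omega _].
    by apply: le_trans (flE omega); rewrite lerD2r.
  rewrite (RintegralD measurableT iZC ifl) (RintegralD measurableT (iZ _ tT) iC).
  rewrite [X in _ + X + _]Rintegral_cst//.
  rewrite [X in fine X](_ : _ = 1%E) ?mulr1; last exact: probability_setT.
  by rewrite -addrA lerD2l /K lerD2l.
have TT : (1 <= T <= T)%N by rewrite hT leqnn.
have fin : T%:R^-1 * \sum_(1 <= t < T.+1) \int[P]_omega q t omega <=
    2 / (eta * T%:R) * \int[P]_omega subopt 1%N omega + 2 / eta * K.
  apply: (@telescoping_average _ (fun t => \int[P]_omega subopt t omega)) => //.
    move=> t /andP[t1 tT]; apply: upper => //; first by rewrite t1 ltnW.
    exact: iZ.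
  have := upper T TT (fun=> 0) (L1_cst _ _) (subopt_ge0 _).
  by rewrite Rintegral_cst// mul0r add0r.
rewrite (L1_EFin (iZ _ T1)) big_nat.
rewrite (eq_bigr (fun t => (\int[P]_omega q t omega)%:E)) => [|t tT];
  last exact: L1_EFin (iq _ tT).
rewrite -big_nat sumEFin -!EFinM -!EFinD lee_fin; apply: le_trans fin _.
rewrite le_eqVlt; apply/orP; left; apply/eqP.
rewrite -addrA; congr (_ + _); rewrite /K /s0.
have N0 : N%:R != 0 :> R by rewrite pnatr_eq0 -lt0n.
have eta0 : eta != 0 by rewrite gt_eqF.
by field; rewrite N0.
Qed.
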